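(* The simply-typed $\lambda\upsilon$-calculus is strongly normalizing: if $\Gamma\vdash t:A$ is derivable for a $\lambda\upsilon$-term $t$, then there is no infinite reduction sequence of the $\lambda\upsilon$-calculus starting from $t$.
   Context: The $\lambda\upsilon$-calculus uses De Bruijn indices $n\geq 1$. Terms $t$ and substitutions $s$ are given by $t ::= n\mid (t\ t)\mid\lambda t\mid t[s]$, $\quad s ::= t/\ \mid\ \Uparrow(s)\ \mid\ \uparrow$. Reduction is the closure under all contexts of the rules $(\lambda t)\,u\to t[u/]$; $(t\ u)[s]\to (t[s])\ (u[s])$; $(\lambda t)[s]\to\lambda(t[\Uparrow(s)])$; $1[t/]\to t$; $(n+1)[t/]\to n$; $1[\Uparrow(s)]\to 1$; $(n+1)[\Uparrow(s)]\to n[s][\uparrow]$; $n[\uparrow]\to n+1$. Simple types are built from atomic types with $\to$; environments are finite lists of types. Typing rules for terms: $\Gamma,A,\Delta\vdash n:A$ where $n=|\Gamma|+1$; from $\Gamma\vdash s\triangleright\Gamma'$ and $\Gamma'\vdash t:A$ infer $\Gamma\vdash t[s]:A$; from $\Gamma\vdash t:B\to A$ and $\Gamma\vdash u:B$ infer $\Gamma\vdash(t\ u):A$; from $B,\Gamma\vdash t:A$ infer $\Gamma\vdash\lambda t:B\to A$. Typing rules for substitutions: from $\Gamma\vdash t:A$ infer $\Gamma\vdash t/\triangleright A,\Gamma$; $A,\Gamma\vdash\uparrow\triangleright\Gamma$; from $\Gamma\vdash s\triangleright\Gamma'$ infer $A,\Gamma\vdash\Uparrow(s)\triangleright A,\Gamma'$.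 *)

(* Defs.v *)
From mathcomp Require Import all_boot.

Set Implicit Arguments.
Unset Strict Implicit.
Unset Printing Implicit Defensive.

(* De Bruijn indices are the positive integers: [Var k] is the index k + 1,
   so [Var 0] is the index 1 and [Var k.+1] is the successor of [Var k]. *)
Inductive term : Type :=
| Var (k : nat)
| App (t u : term)
| Lam (t : term)
| Clos (t : term) (s : subst)        (* t[s] *)
with subst : Type :=
| Slash (t : term)                   (* t/ *)
| Lift (s : subst)                   (* ⇑(s) *)
| Shift.                             (* ↑ *)

Inductive step : term -> term -> Prop :=
| step_B t u : step (App (Lam t) u) (Clos t (Slash u))
| step_App t u s : step (Clos (App t u) s) (App (Clos t s) (Clos u s))
| step_Lam t s : step (Clos (Lam t) s) (Lam (Clos t (Lift s)))
| step_FVar t : step (Clos (Var 0) (Slash t)) t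
| step_RVar k t : step (Clos (Var k.+1) (Slash t)) (Var k)
| step_FVarLift s : step (Clos (Var 0) (Lift s)) (Var 0)
| step_RVarLift k s :
    step (Clos (Var k.+1) (Lift s)) (Clos (Clos (Var k) s) Shift)
| step_VarShift k : step (Clos (Var k) Shift) (Var k.+1)
| step_appl t t' u : step t t' -> step (App t u) (App t' u)
| step_appr t u u' : step u u' -> step (App t u) (App t u')
| step_lam t t' : step t t' -> step (Lam t) (Lam t')
| step_closl t t' s : step t t' -> step (Clos t s) (Clos t' s)
| step_closr t s s' : sstep s s' -> step (Clos t s) (Clos t s')
with sstep : subst -> subst -> Prop :=
| sstep_slash t t' : step t t' -> sstep (Slash t) (Slash t')
| sstep_lift s s' : sstep s s' -> sstep (Lift s) (Lift s').

Inductive type (atom : Type) : Type :=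
| Atom (a : atom)
| Arrow (A B : type atom).

Definition env (atom : Type) : Type := seq (type atom).

(* [typed G t A] is G ⊢ t : A and [styped G s G'] is G ⊢ s ▷ G'.
   The head of an environment is the type of the index 1. *)
Inductive typed (atom : Type) : env atom -> term -> type atom -> Prop :=
| typed_var (G D : env atom) A : typed (G ++ A :: D) (Var (size G)) A
| typed_clos G G' t s A :
    styped G s G' -> typed G' t A -> typed G (Clos t s) A
| typed_app G t u A B :
    typed G t (Arrow B A) -> typed G u B -> typed G (App t u) A
| typed_lam G t A B : typed (B :: G) t A -> typed G (Lam t) (Arrow B A)
with styped (atom : Type) : env atom -> subst -> env atom -> Prop :=
| styped_slash G t A : typed G t A -> styped G (Slash t) (A :: G)
| styped_shift G A : styped (A :: G) Shift G
| styped_lift G G' s A :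
    styped G s G' -> styped (A :: G) (Lift s) (A :: G').

Definition infinite_reduction_from (t : term) (f : nat -> term) : Prop :=
  f 0 = t /\ forall i, step (f i) (f i.+1).

(* Main.v *)
(** Typed terms are interpreted by weakly monotone functionals carrying a
    natural number, the weight, in the style of Gandy, with one extra argument:
    a number [g] standing for the garbage under which a term is evaluated.
    A closure t[u/] adds the weight of u to the garbage, and every variable
    charges all the garbage it sees, so reductions inside substitutions that
    will be discarded are accounted for. The garbage added by a substitution is
    computed in the least environment: until u replaces a variable, no other
    substitution can act on it. With these choices no rule increases the
    interpretation and the Beta rule strictly decreases the weight, in every
    context. The remaining rules decrease lexicographically two polynomial
    measures of untyped terms. *)
Require Import Defs.
From mathcomp Require Import all_boot zify.

Set Implicit Arguments.
Unset Strict Implicit.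
Unset Printing Implicit Defensive.

Scheme term_mut := Induction for term Sort Prop
  with subst_mut := Induction for subst Sort Prop.
Combined Scheme term_subst_ind from term_mut, subst_mut.

Scheme step_mut := Minimality for step Sort Prop
  with sstep_mut := Minimality for sstep Sort Prop.
Combined Scheme step_sstep_ind from step_mut, sstep_mut.

Scheme typed_mut := Minimality for typed Sort Prop
  with styped_mut := Minimality for styped Sort Prop.
Combined Scheme typed_styped_ind from typed_mut, styped_mut.

(** * Measures for the substitution rules *)

(** The values [2 ^ k] and 2 make the rules for n[↑] and (n+1)[⇑(s)] preserve [size1]. All other
    rules except Beta decrease it: a closure multiplies, so pushing a factor above 1 under a
    constructor saves more than it costs. *)
Fixpoint size1 (t : term) : nat :=
  match t with
  | Var k => 2 ^ k
  | App t u => (size1 t + size1 u).+1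
  | Lam t => (size1 t).+1
  | Clos t s => size1 t * ssize1 s
  end
with ssize1 (s : subst) : nat :=
  match s with
  | Slash t => (size1 t).+1
  | Lift s => ssize1 s
  | Shift => 2
  end.

(* Decreases for the two rules that preserve [size1]: those for (n+1)[⇑(s)]
   and n[↑]. *)
Fixpoint size2 (t : term) : nat :=
  match t with
  | Var _ => 1
  | App t u => size2 t + size2 u
  | Lam t => size2 t
  | Clos t s => size2 t + ssize2 s
  end
with ssize2 (s : subst) : nat :=
  match s with
  | Slash t => size2 t
  | Lift s => (ssize2 s).+2
  | Shift => 1
  end.

Definition lexlt (x y : nat * nat) : Prop :=
  x.1 < y.1 \/ x.1 = y.1 /\ x.2 < y.2.

Definition sizes (t : term) := (size1 t, size2 t).
Definition ssizes (s : subst) := (ssize1 s, ssize2 s).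

(** The bound for substitutions makes the rules for (t u)[s] and (λt)[s] strict; positivity of both
    factors makes the product for a closure strictly monotone. *)
Lemma sizes_gt :
  (forall t, 0 < size1 t) /\ (forall s, 1 < ssize1 s).
Proof.
apply: term_subst_ind => //= [k|t Ht s Hs]; first by rewrite expn_gt0.
by rewrite muln_gt0 Ht /=; lia.
Qed.

(** * Derivations as data *)

Fixpoint lookup_ty {atom} (k : nat) (G : env atom) (A : type atom)
    {struct G} : Type :=
  match G, k with
  | [::], _ => Empty_set
  | B :: _, 0 => B = A
  | _ :: G, k.+1 => lookup_ty k G A
  end.

(** [typed] lives in [Prop], so values cannot be computed from its proofs. Recursion on the term
    makes inversion of a derivation a computation. *)
Fixpoint deriv {atom} (t : term) (G : env atom) (A : type atom) : Type :=
  match t with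
  | Var k => lookup_ty k G A
  | App t u => {B : type atom & (deriv t G (Arrow B A) * deriv u G B)%type}
  | Lam t =>
      match A with
      | Atom _ => Empty_set
      | Arrow B C => deriv t (B :: G) C
      end
  | Clos t s => {G' : env atom & (sderiv s G G' * deriv t G' A)%type}
  end
with sderiv {atom} (s : subst) (G G' : env atom) : Type :=
  match s with
  | Slash t =>
      match G' with
      | [::] => Empty_set
      | A :: G1 => ((G1 = G) * deriv t G A)%type
      end
  | Lift s =>
      match G, G' with
      | A :: G1, A' :: G1' => ((A = A') * sderiv s G1 G1')%type
      | _, _ => Empty_set
      end
  | Shift => {A : type atom & G = A :: G'}
  end.

Lemma typed_deriv {atom : Type} :
  (forall G t (A : type atom), typed G t A -> inhabited (deriv t G A)) /\
  (forall G s (G' : env atom), styped G s G' -> inhabited (sderiv s G G')).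
Proof.
apply: typed_styped_ind => /=.
- by move=> G D A; elim: G => //= [|B G [v]]; constructor.
- by move=> G G' t s A _ [ds] _ [dt]; constructor; exists G'.
- by move=> G t u A B _ [dt] _ [du]; constructor; exists B.
- by [].
- by move=> G t A _ [dt]; constructor.
- by move=> G A; constructor; exists A.
- by move=> G G' s A _ [ds]; constructor.
Qed.

(** * Values *)

(* A function carries its own weight besides its action. Its argument still
   waits for the garbage under which it will be evaluated. *)
Fixpoint val {atom} (A : type atom) : Type :=
  match A with
  | Atom _ => nat
  | Arrow B C => (nat * ((nat -> val B) -> val C))%type
  end.

Definition wt {atom} (A : type atom) : val A -> nat :=
  match A with
  | Atom _ => fun n => n
  | Arrow B C => fun v => v.1
  end.

Definition raise {atom} (k : nat) (A : type atom) : val A -> val A :=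
  match A with
  | Atom _ => fun n => n + k
  | Arrow B C => fun v => (v.1 + k, v.2)
  end.

Fixpoint bot {atom} (A : type atom) : val A :=
  match A with
  | Atom _ => 0
  | Arrow B C => (0, fun _ => bot C)
  end.

(* Relates functionals on all pairs of related arguments, so that a value is
   monotone exactly when it is related to itself. *)
Fixpoint vle {atom} (A : type atom) : val A -> val A -> Prop :=
  match A with
  | Atom _ => fun m n => m <= n
  | Arrow B C => fun v v' => v.1 <= v'.1 /\
      forall a a' : nat -> val B,
        (forall k k', k <= k' -> vle (a k) (a' k')) -> vle (v.2 a) (v'.2 a')
  end.

(** The condition on arguments in [vle]: [fle a a] includes monotonicity of [a] in the garbage. *)
Definition fle {atom} (A : type atom) (a a' : nat -> val A) : Prop :=
  forall k k', k <= k' -> vle (a k) (a' k').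

Lemma vle_bot {atom} (A : type atom) (v : val A) : vle (bot A) v.
Proof. by elim: A v => //= B _ C IH v; split. Qed.

Lemma vle_wt {atom} (A : type atom) (v v' : val A) : vle v v' -> wt v <= wt v'.
Proof. by case: A v v' => //= B C v v' []. Qed.

Lemma wt_raise {atom} k (A : type atom) (v : val A) : wt (raise k v) = wt v + k.
Proof. by case: A v. Qed.

Lemma vle_raise {atom} k k' (A : type atom) (v v' : val A) :
  k <= k' -> vle v v' -> vle (raise k v) (raise k' v').
Proof.
move=> le_k; case: A v v' => /= [_|B C] v v'.
  by move=> le_v; apply: leq_add.
by case=> le1 le2; split=> //; apply: leq_add.
Qed.

Lemma vle_raiser {atom} k (A : type atom) (v v' : val A) :
  vle v v' -> vle v (raise k v').
Proof.
case: A v v' => /= [_|B C] v v'.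
  by move=> /leq_trans-> //; apply: leq_addr.
by case=> le1 le2; split=> //; apply: leq_trans le1 (leq_addr _ _).
Qed.

Fixpoint venv {atom} (G : env atom) : Type :=
  match G with
  | [::] => unit
  | A :: G => ((nat -> val A) * venv G)%type
  end.

Fixpoint venv_bot {atom} (G : env atom) : venv G :=
  match G with
  | [::] => tt
  | A :: G => (fun _ => bot A, venv_bot G)
  end.

Fixpoint venv_le {atom} (G : env atom) : venv G -> venv G -> Prop :=
  match G with
  | [::] => fun _ _ => True
  | A :: G => fun r r' => fle r.1 r'.1 /\ venv_le r.2 r'.2
  end.

Lemma venv_le_bot {atom} (G : env atom) (r : venv G) : venv_le (venv_bot G) r.
Proof. by elim: G r => //= A G IH r; split=> // k k' _; apply: vle_bot. Qed.

(** * Interpretation of derivations *)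

Fixpoint lookup {atom} (k : nat) (G : env atom) (A : type atom) {struct G} :
    lookup_ty k G A -> venv G -> nat -> val A :=
  match G return lookup_ty k G A -> venv G -> nat -> val A with
  | [::] => fun v => match v with end
  | B :: G =>
      match k
        return lookup_ty k (B :: G) A -> venv (B :: G) -> nat -> val A with
      | 0 => fun e r => match e with erefl => r.1 end
      | k.+1 => fun v r => @lookup atom k G A v r.2
      end
  end.

(* [(sden s d).2] is the garbage added by [s]. In the application case the
   argument keeps the garbage [g] already present, which makes the rule for
   (t u)[s] an equality. *)
Fixpoint den {atom} (t : term) (G : env atom) (A : type atom) :
    deriv t G A -> venv G -> nat -> val A :=
  match t return deriv t G A -> venv G -> nat -> val A with
  | Var k => fun d r g => raise g (@lookup atom k G A d r g)
  | App t u => fun d r g =>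
      let f := @den atom t G _ (projT2 d).1 r g in
      let a k := @den atom u G _ (projT2 d).2 r (g + k) in
      raise (f.1 + wt (a 0)).+1 (f.2 a)
  | Lam t =>
      match A return deriv (Lam t) G A -> venv G -> nat -> val A with
      | Atom _ => fun d => match d with end
      | Arrow B C => fun d r g =>
          (wt (@den atom t (B :: G) C d (fun _ => bot B, r) g),
           fun a => @den atom t (B :: G) C d (a, r) (g + wt (a 0)))
      end
  | Clos t s => fun d r g =>
      let ds := @sden atom s G _ (projT2 d).1 in
      @den atom t _ A (projT2 d).2 (ds.1 r) (g + ds.2)
  end
with sden {atom} (s : subst) (G G' : env atom) :
    sderiv s G G' -> (venv G -> venv G') * nat :=
  match s return sderiv s G G' -> (venv G -> venv G') * nat with
  | Slash t =>
      match G' return sderiv (Slash t) G G' -> (venv G -> venv G') * nat with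
      | [::] => fun d => match d with end
      | A :: G1 => fun d =>
          (fun r => (@den atom t G A d.2 r, eq_rect_r venv r d.1),
           wt (@den atom t G A d.2 (venv_bot G) 0))
      end
  | Lift s =>
      match G, G' return sderiv (Lift s) G G' -> (venv G -> venv G') * nat with
      | A :: G1, A' :: G1' => fun d =>
          let ds := @sden atom s G1 G1' d.2 in
          (fun r => (ecast B (nat -> val B) d.1 r.1, ds.1 r.2), ds.2)
      | [::], _ => fun d => match d with end
      | _ :: _, [::] => fun d => match d with end
      end
  | Shift => fun d =>
      (fun r => (ecast G0 (venv G0) (projT2 d) r).2, 0)
  end.

Arguments den {atom} t {G A} d r g.
Arguments sden {atom} s {G G'} d.

Lemma lookup_mono {atom} k (G : env atom) A (v : lookup_ty k G A) r r' :
  venv_le r r' -> fle (lookup v r) (lookup v r').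
Proof.
elim: G k v r r' => [|B G IH] [|k] //= v r r' [le1 le2]; last exact: IH.
by case: _ / v.
Qed.

(** Strictness in [g] comes from the variables, each of which adds its garbage to the weight. It
    later turns a drop in the garbage of a substitution into a drop in the weight of the closure. *)
Lemma den_mono {atom : Type} :
  (forall t (G : env atom) A (d : deriv t G A) r r' g g',
     venv_le r r' -> g <= g' ->
     vle (den t d r g) (den t d r' g') /\
     (g < g' -> wt (den t d r g) < wt (den t d r' g'))) /\
  (forall s (G G' : env atom) (d : sderiv s G G') r r',
     venv_le r r' -> venv_le ((sden s d).1 r) ((sden s d).1 r')).
Proof.
apply: term_subst_ind.
- move=> k G A d r r' g g' le_r le_g /=.
  have le_vg := @lookup_mono _ _ _ _ d _ _ le_r _ _ le_g.
  split; first exact: vle_raise.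
  by rewrite !wt_raise => lt_g; have := vle_wt le_vg; lia.
- move=> t IHt u IHu G A [B [dt du]] r r' g g' le_r le_g /=.
  have [[le_f1 le_f2] lt_f] := IHt _ _ dt _ _ _ _ le_r le_g.
  set a := fun k => den u du r (g + k); set a' := fun k => den u du r' (g' + k).
  have le_a : fle a a'.
    by move=> k k' le_k; apply: (IHu _ _ du _ _ _ _ le_r _).1; apply: leq_add.
  have le_a0 := vle_wt (le_a 0 0 isT); have le_fa := le_f2 _ _ le_a.
  split.
    by apply: vle_raise => //; rewrite /a /a' in le_a0 *; lia.
  rewrite !wt_raise => /lt_f /= ?; have := vle_wt le_fa.
  by rewrite /a /a' in le_a0 *; lia.
- move=> t IHt G [//|B C] d r r' g g' le_r le_g /=.
  have le_b : @venv_le _ (B :: G) (fun=> bot B, r) (fun=> bot B, r').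
    by split=> // k k' _; apply: vle_bot.
  have [le_t lt_t] := IHt _ _ d _ _ _ _ le_b le_g.
  split=> //; split=> [|a a' le_a]; first exact: vle_wt.
  apply: (IHt (B :: G) _ d (a, r) (a', r') _ _ _ _).1 => //.
  by apply: leq_add => //; apply/vle_wt/le_a.
- move=> t IHt s IHs G A [G' [ds dt]] r r' g g' le_r le_g /=.
  have le_s := IHs _ _ ds _ _ le_r.
  have le_gs : g + (sden s ds).2 <= g' + (sden s ds).2 by rewrite leq_add2r.
  have [le_t lt_t] := IHt _ _ dt _ _ _ _ le_s le_gs.
  by split=> // lt_g; apply: lt_t; rewrite ltn_add2r.
- move=> t IHt G [//|A G'] [e d] r r' le_r.
  case: _ / e d r r' le_r => /= d r r' le_r.
  by split=> // k k' le_k; apply: (IHt _ _ d _ _ _ _ le_r le_k).1.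
- move=> s IHs [|A G] [|A' G'] //= [e d] r r' [le1 le2].
  by split; [case: _ / e | apply: IHs].
- by move=> G G' [A e]; subst G => r r' [].
Qed.

(** * Comparison of derivations and the effect of one reduction step *)

Definition den_le {atom} t t' (G : env atom) A
    (d : deriv t G A) (d' : deriv t' G A) :=
  forall r r' g g', venv_le r r' -> g <= g' ->
    vle (den t d r g) (den t' d' r' g').

Definition den_lt {atom} t t' (G : env atom) A
    (d : deriv t G A) (d' : deriv t' G A) :=
  forall r r' g g', venv_le r r' -> g <= g' ->
    wt (den t d r g) < wt (den t' d' r' g').

Definition sden_le {atom} s s' (G G' : env atom)
    (d : sderiv s G G') (d' : sderiv s' G G') :=
  (forall r r', venv_le r r' -> venv_le ((sden s d).1 r) ((sden s' d').1 r')) /\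
  (sden s d).2 <= (sden s' d').2.

(** [venv_le] is reflexive only on monotone environments, so comparisons range over related pairs
    and reflexivity amounts to monotonicity of the interpretation. *)
Lemma den_refl {atom} t (G : env atom) A (d : deriv t G A) : den_le d d.
Proof.
move=> r r' g g' le_r le_g.
exact: (den_mono.1 _ _ _ _ _ _ _ _ le_r le_g).1.
Qed.

(** The weight of an application contains [f.1] and [wt (a 0)] as summands, so a strict drop on
    either side survives even if the function ignores its argument. *)
Lemma den_app_le {atom} t t' u u' (G : env atom) A B
    (dt : deriv t G (Arrow B A)) (dt' : deriv t' G (Arrow B A))
    (du : deriv u G B) (du' : deriv u' G B) :
  den_le dt dt' -> den_le du du' ->
  let d : deriv (App t u) G A := existT _ B (dt, du) in
  let d' : deriv (App t' u') G A := existT _ B (dt', du') in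
  den_le d d' /\ (den_lt dt dt' \/ den_lt du du' -> den_lt d d').
Proof.
move=> le_t le_u d d'.
have app_bounds r r' g g' : venv_le r r' -> g <= g' ->
    let f := den t dt r g in let f' := den t' dt' r' g' in
    let a k := den u du r (g + k) in let a' k := den u' du' r' (g' + k) in
    [/\ f.1 <= f'.1, wt (a 0) <= wt (a' 0) & vle (f.2 a) (f'.2 a')].
  move=> le_r le_g f f' a a'; have [le1 le2] := le_t _ _ _ _ le_r le_g.
  split=> //; first by apply/vle_wt/le_u => //; apply: leq_add.
  by apply: le2 => k k' le_k; apply: le_u => //; apply: leq_add.
split=> [|lt_tu] r r' g g' le_r le_g;
  have /= [le1 le2 le3] := app_bounds _ _ _ _ le_r le_g.
  by apply: vle_raise => //; lia.
rewrite /= !wt_raise; have := vle_wt le3.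
case: lt_tu => [/(_ _ _ _ _ le_r le_g) /= | lt_u]; first by lia.
have := lt_u _ _ (g + 0) (g' + 0) le_r; rewrite leq_add2r => /(_ le_g); lia.
Qed.

Lemma lexlt_app t t' u u' :
  lexlt (sizes t) (sizes t') /\ sizes u = sizes u' \/
    sizes t = sizes t' /\ lexlt (sizes u) (sizes u') ->
  lexlt (sizes (App t u)) (sizes (App t' u')).
Proof. by rewrite /lexlt /sizes /=; case=> [[? [? ?]]|[[? ?] ?]]; lia. Qed.

Lemma lexlt_clos t t' s s' :
  lexlt (sizes t) (sizes t') /\ ssizes s = ssizes s' \/
    sizes t = sizes t' /\ lexlt (ssizes s) (ssizes s') ->
  lexlt (sizes (Clos t s)) (sizes (Clos t' s')).
Proof.
have t_gt0 := sizes_gt.1 t'; have := sizes_gt.2 s'.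
rewrite /lexlt /sizes /ssizes /= => s_gt1.
case=> [[h [e1 e2]]|[[e1 e2] h]]; case: h; rewrite e1 ?e2 => h.
- by left; rewrite ltn_pmul2r //; lia.
- by right; case: h => -> ?; split=> //; lia.
- by left; rewrite ltn_pmul2l.
- by right; case: h => -> ?; split=> //; lia.
Qed.

(** Subject reduction is included: each case builds the derivation of the reduct. The weak
    comparison holds at every step, so a step that only lowers the sizes cannot raise the weight. *)
Lemma step_decreases {atom : Type} :
  (forall t t', step t t' -> forall (G : env atom) A (d : deriv t G A),
     exists d' : deriv t' G A, den_le d' d /\
       (den_lt d' d \/ lexlt (sizes t') (sizes t))) /\
  (forall s s', sstep s s' -> forall (G G' : env atom) (d : sderiv s G G'),
     exists d' : sderiv s' G G', sden_le d' d /\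
       ((sden s' d').2 < (sden s d).2 \/ lexlt (ssizes s') (ssizes s))).
Proof.
apply: step_sstep_ind.
- move=> t u G A [B [dt du]].
  exists (existT _ (B :: G) ((erefl, du), dt)).
  (* The garbage [c] of u/ is measured in the least environment under garbage 0, hence is at most
     the [wt (a 0)] that the abstraction adds to the garbage of its body. The successor in the
     application clause then gives strictness. *)
  have bound r r' g g' : venv_le r r' -> g <= g' ->
      let a k := den u du r' (g' + k) in
      let c := wt (den u du (venv_bot G) 0) in
      vle (den t dt (den u du r, r) (g + c)) (den t dt (a, r') (g' + wt (a 0))).
    move=> le_r le_g a c; apply: den_refl; first split=> //.
      by move=> k k' le_k; apply: den_refl => //=; lia.
    by apply: leq_add => //; apply/vle_wt/den_refl; first exact: venv_le_bot.
  split; [|left]; move=> r r' g g' le_r le_g;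
    have /= le_t := bound _ _ _ _ le_r le_g.
    exact: vle_raiser.
  by rewrite /= wt_raise; have := vle_wt le_t; rewrite /eq_rect_r /=; lia.
- move=> t u s G A [G' [ds [B [dt du]]]].
  exists (existT _ B (existT _ G' (ds, dt), existT _ G' (ds, du))); split.
    move=> r r' g g' le_r le_g.
    have le_s := den_mono.2 _ _ _ ds _ _ le_r.
    have le_gs : g + (sden s ds).2 <= g' + (sden s ds).2 by rewrite leq_add2r.
    have [le1 le2] := den_refl dt le_s le_gs.
    apply: vle_raise => /=.
      by rewrite ltnS leq_add //; apply/vle_wt/den_refl => //; lia.
    by apply: le2 => k k' le_k; apply: den_refl => //; lia.
  right; left; rewrite /=; have := sizes_gt.2 s; nia.
- move=> t s G [a|B C] [G' [ds dt]] //.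
  (* ⇑(s) adds the same garbage as s and passes the bound variable through, so both sides evaluate
     the body alike, up to the order of the garbage summands. *)
  exists (existT _ (B :: G') ((erefl, ds), dt)); split.
    move=> r r' g g' le_r le_g /=.
    have le_s := den_mono.2 _ _ _ ds _ _ le_r; split=> [|a a' le_a] /=.
      apply/vle_wt/den_refl; last by rewrite leq_add2r.
      by split=> // k k' _; apply: vle_bot.
    apply: den_refl; first by split.
    by have := vle_wt (le_a 0 0 isT); lia.
  right; left; rewrite /=; have := sizes_gt.2 s; nia.
- move=> t G A [[|B G'] [ds v]] //; case: ds v => e d /= v; subst G' B.
  exists d; split; last by right; left => /=; lia.
  move=> r r' g g' le_r le_g /=; apply: vle_raiser; apply: den_refl => //; lia.
- move=> k t G A [[|B G'] [ds v]] //; case: ds v => e d /= v; subst G'.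
  exists v; split; last first.
    by right; left => /=; rewrite expnS; have := sizes_gt.1 t; nia.
  move=> r r' g g' le_r le_g /=.
  by apply: vle_raise; [|apply: lookup_mono => //]; lia.
- move=> s [|B G] A [[|B' G'] [ds v]] //; case: ds v => e ds /= v; subst B' B.
  exists erefl; split; last by right; left; rewrite /= mul1n; apply: sizes_gt.2.
  move=> r r' g g' [le_r1 le_r2] le_g /=.
  by apply: vle_raise; [|apply: le_r1]; apply: leq_trans le_g (leq_addr _ _).
- move=> k s [|B G] A [[|B' G'] [ds v]] //; case: ds v => e ds /= v; subst B'.
  exists (existT _ G (existT _ B erefl, existT _ G' (ds, v))); split; last first.
    by right; right; split=> /=; rewrite ?expnS; lia.
  move=> r r' g g' [_ le_r] le_g /=; have le_s := den_mono.2 _ _ _ ds _ _ le_r.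
  by apply: vle_raise; [|apply: lookup_mono => //]; lia.
- move=> k G A [G' [[B e] v]]; move: e v => /= e v; subst G.
  exists v; split; last first.
    by right; right; split=> /=; rewrite ?expnS; lia.
  move=> r r' g g' [_ le_r] le_g /=.
  by apply: vle_raise; [|apply: lookup_mono => //]; lia.
- move=> t t' u _ IH G A [B [dt du]]; have [dt' [le_t lt_t]] := IH _ _ dt.
  have [le lt] := den_app_le le_t (@den_refl _ _ _ _ du).
  exists (existT _ B (dt', du)); split=> //.
  case: lt_t => h; [left; apply: lt; left | right; apply: lexlt_app; left] => //.
- move=> t u u' _ IH G A [B [dt du]]; have [du' [le_u lt_u]] := IH _ _ du.
  have [le lt] := den_app_le (@den_refl _ _ _ _ dt) le_u.
  exists (existT _ B (dt, du')); split=> //.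
  case: lt_u => h; [left; apply: lt; right | right; apply: lexlt_app; right] => //.
- move=> t t' _ IH G [a|B C] d //; have [d' [le_d lt_d]] := IH _ _ d.
  have le_b r r' : @venv_le _ G r r' ->
      @venv_le _ (B :: G) (fun=> bot B, r) (fun=> bot B, r').
    by split=> // k k' _; apply: vle_bot.
  exists d'; split.
    move=> r r' g g' le_r le_g; split=> [|a a' le_a] /=.
      by apply/vle_wt/le_d => //; apply: le_b.
    by apply: le_d => //; apply: leq_add => //; apply/vle_wt/le_a.
  (* The weight of an abstraction is that of its body at the least argument, where strictness is
     applied. *)
  case: lt_d => h; [left | by right; move: h; rewrite /lexlt /=; lia].
  by move=> r r' g g' le_r le_g /=; apply: h => //; apply: le_b.
- move=> t t' s _ IH G A [G' [ds dt]]; have [dt' [le_t lt_t]] := IH _ _ dt.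
  exists (existT _ G' (ds, dt')); split.
    move=> r r' g g' le_r le_g /=; apply: le_t; last by rewrite leq_add2r.
    exact: den_mono.2.
  case: lt_t => h; [left | by right; apply: lexlt_clos; left].
  move=> r r' g g' le_r le_g /=; apply: h; last by rewrite leq_add2r.
  exact: den_mono.2.
- move=> t s s' _ IH G A [G' [ds dt]].
  have [ds' [[le_s1 le_s2] lt_s]] := IH _ _ ds.
  exists (existT _ G' (ds', dt)); split.
    move=> r r' g g' le_r le_g /=.
    by apply: den_refl; [apply: le_s1 | apply: leq_add].
  case: lt_s => h; [left | by right; apply: lexlt_clos; right].
  move=> r r' g g' le_r le_g /=.
  apply: (den_mono.1 _ _ _ _ _ _ _ _ (le_s1 _ _ le_r) _).2; first exact: leq_add.
  by rewrite -addnS leq_add.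
- move=> t t' _ IH G [//|A G'] [e d]; have [d' [le_d lt_d]] := IH _ _ d.
  exists (e, d'); subst G'; split.
    split=> [r r' le_r|]; last by apply/vle_wt/le_d => //; apply: venv_le_bot.
    by split=> //= k k' le_k; apply: le_d.
  case: lt_d => h; [left | by right; move: h; rewrite /lexlt /=; lia].
  by apply: h => //; apply: venv_le_bot.
- move=> s s' _ IH [|A G] [|A' G'] // [e d].
  have [d' [[le1 le2] lt_d]] := IH _ _ d.
  exists (e, d'); subst A'; split.
    by split=> //= r r' [le_r1 le_r2]; split=> //; apply: le1.
  case: lt_d => h; [by left | by right; move: h; rewrite /lexlt /=; lia].
Qed.

(** * Termination *)

Lemma lexlt_wf : well_founded lexlt.
Proof.
case=> m n; elim/ltn_ind: m n => m IHm n; elim/ltn_ind: n => n IHn.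
by constructor=> -[m' n'] [/IHm | /= [-> /IHn]].
Qed.

Lemma deriv_acc {atom : Type} t (G : env atom) A :
  deriv t G A -> Acc (fun t' t => step t t') t.
Proof.
pose w t (d : deriv t G A) := wt (den t d (venv_bot G) 0).
(* Outer induction on a bound for the weight, inner induction on the sizes. A bound suits the inner
   steps, which may also change the weight but never increase it. *)
move=> d; have [n] := ubnP (w t d).
elim: n t d => [t d|n IHn t d]; first by rewrite ltn0.
rewrite ltnS.
have [x def_x] : exists x, x = sizes t by exists (sizes t).
elim/(well_founded_ind lexlt_wf): x t d def_x => x IHx t d def_x le_w.
constructor=> t' /step_decreases.1 /(_ _ _ d) [d' [le_d lt_d]].
have le_b := venv_le_bot (venv_bot G).
case: lt_d => [/(_ _ _ 0 0 le_b isT) lt_w | lt_x].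
  by apply: (IHn t' d'); apply: leq_trans lt_w le_w.
apply: (IHx _ _ _ d') => //; first by rewrite def_x.
by apply: leq_trans le_w; apply/vle_wt/le_d.
Qed.

Theorem corollary4p17 (atom : Type) (G : env atom) (t : term) (A : type atom)
    (Ht : typed G t A) :
  ~ exists f : nat -> term, infinite_reduction_from t f.
Proof.
have [d] := typed_deriv.1 _ _ _ Ht; have acc_t := deriv_acc d.
case=> f [f0 step_f]; move: acc_t; rewrite -f0; move: 0.
(* Generalizing over the position [i] lets the induction on accessibility pass from [f i] to its
   reduct [f i.+1]. *)
suff no_acc x : Acc (fun t' t => step t t') x -> forall i, f i <> x.
  by move=> i /no_acc /(_ i).
by elim=> {}x _ IH i fi; apply: (IH (f i.+1) _ i.+1) => //; rewrite -fi.
Qed.
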